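(* Let $R$ be an $h$-local Prüfer domain. Then: (1) For each divisorial ideal $I$ of $R$, if $M \supseteq I$ with $M$ a nondivisorial maximal ideal of $R$, then $IR_M$ is divisorial in $R_M$, and $IR_M$ is properly contained in $MR_M$. (2) For each nonzero nondivisorial ideal $I$ of $R$, $I$ factors as a product $I = BM_1M_2\cdots M_n$ where $B$ is a divisorial ideal of $R$ and the $M_i$ are distinct nondivisorial maximal ideals of $R$ that contain $I$ and for which $IR_{M_i}$ is not a divisorial ideal of $R_{M_i}$. Moreover, this factorization is unique in the sense that (in any such factorization) $B = I^v$ and the $M_i$ include all nondivisorial maximal ideals $M$ of $R$ that contain $I$ and for which $IR_M$ is not divisorial in $R_M$.
   Context: For an integral domain $D$ with quotient field $K$ and a nonzero fractional ideal $F$ of $D$, put $F^{-1} = (D:F) = \{x \in K \mid xF \subseteq D\}$ and $F^v = (F^{-1})^{-1}$ (the divisorial closure of $F$). A nonzero ideal $F$ is divisorial if $F = F^v$; divisoriality of an ideal of $R_M$ is understood with respect to the domain $R_M$. An integral domain $R$ has finite character if each nonzero element of $R$ is contained in only finitely many maximal ideals, and $R$ is $h$-local if it has finite character and each nonzero prime ideal of $R$ is contained in a unique maximal ideal of $R$. *)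

(* Defs.v *)
From HB Require Import structures.
From mathcomp Require Import all_boot all_order all_algebra.
From mathcomp Require Import boolp classical_sets functions cardinality.

Set Implicit Arguments.
Unset Strict Implicit.
Unset Printing Implicit Defensive.

Import GRing.Theory.
Local Open Scope classical_set_scope.
Local Open Scope ring_scope.

(* Every domain D below is a subring of a field K that is its quotient field,
   and ideals of D are subsets of K.  Thus R and its localizations R_M live in
   the same K, and D is an explicit parameter of each notion.  An abstract
   integral domain R enters through its copy inside {fraction R}. *)
Definition domain_image (R : idomainType) : set {fraction R} :=
  range (@tofrac R).
Arguments domain_image R : clear implicits.

Section Ideals.
Variable K : fieldType.
Implicit Types (D F G I J M P : set K) (x y : K).

Definition submodule D F : Prop :=
  [/\ F 0,
      forall x y, F x -> F y -> F (x + y)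
    & forall a x, D a -> F x -> F (a * x)].

Definition ideal D I : Prop := submodule D I /\ I `<=` D.

Definition nonzero_ideal D I : Prop :=
  ideal D I /\ exists2 x, I x & x != 0.

Definition prime_ideal D P : Prop :=
  [/\ ideal D P, P <> D
    & forall x y, D x -> D y -> P (x * y) -> P x \/ P y].

Definition maximal_ideal D M : Prop :=
  [/\ ideal D M, M <> D
    & forall J, ideal D J -> M `<=` J -> J = M \/ J = D].

(* For J := localization D M this is the extended ideal I D_M. *)
Definition ideal_mul I J : set K :=
  [set x | exists n (a b : 'I_n -> K),
     [/\ forall i, I (a i), forall i, J (b i)
       & x = \sum_(i < n) a i * b i]].

Definition ideal_inv D F : set K :=
  [set x | forall y, F y -> D (x * y)].

Definition v_closure D F : set K := ideal_inv D (ideal_inv D F).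

Definition divisorial D I : Prop := nonzero_ideal D I /\ I = v_closure D I.

(* The zero ideal is neither divisorial nor nondivisorial. *)
Definition nondivisorial D I : Prop := nonzero_ideal D I /\ I <> v_closure D I.

Definition localization D M : set K :=
  [set x | exists a s, [/\ D a, D s, ~ M s & x = a / s]].

Definition finitely_generated D F : Prop :=
  exists n (g : 'I_n -> K),
    F = [set x | exists2 a : 'I_n -> K,
           forall i, D (a i) & x = \sum_(i < n) a i * g i].

Definition invertible D F : Prop := ideal_mul F (ideal_inv D F) = D.

Definition prufer D : Prop :=
  forall F, nonzero_ideal D F -> finitely_generated D F -> invertible D F.

Definition finite_character D : Prop :=
  forall x, D x -> x != 0 -> finite_set [set M | maximal_ideal D M /\ M x].

Definition h_local D : Prop :=
  finite_character D /\
  forall P, prime_ideal D P -> nonzero_ideal D P ->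
    exists! M, maximal_ideal D M /\ P `<=` M.

Definition nondivisorial_maximal_at D I M : Prop :=
  [/\ maximal_ideal D M, nondivisorial D M, I `<=` M
    & nondivisorial (localization D M) (ideal_mul I (localization D M))].

Definition factorization D I B n (M : 'I_n -> set K) : Prop :=
  [/\ divisorial D B,
      injective M,
      forall i, nondivisorial_maximal_at D I (M i)
    & I = ideal_mul B (\big[ideal_mul/D]_(i < n) M i)].

End Ideals.

(* Main.v *)
Require Import Defs.
From HB Require Import structures.
From mathcomp Require Import all_boot all_order all_algebra.
From mathcomp Require Import boolp classical_sets functions cardinality.
From mathcomp Require Import ring.

Set Implicit Arguments.
Unset Strict Implicit.
Unset Printing Implicit Defensive.

Import GRing.Theory.
Local Open Scope classical_set_scope.
Local Open Scope ring_scope.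

(** Work inside the quotient field K of the domain D.  Two facts about
    localizations drive everything.

    Valuation theory.  As D is Pruefer, each D_M is a valuation domain
    ([localized_valuation]).  In a valuation domain V with maximal ideal m, a
    submodule J satisfies J^v m <= J ([localized_v_mul]): if b is in J^v, p is in
    m and bp is not in J, then J lies in bpV, hence so does J^v, and b would be a
    multiple of bp.  So J is either divisorial or equal to J^v m.

    Independence.  As D is h-local, the localizations at distinct maximal ideals
    are independent: every nonzero b of D divides, in all D_N with N <> M at
    once, some t outside M ([separate]).  Multiplying by such a t clears the
    denominators of a bounded family of elements of D_M, so forming (D : F), and
    therefore also the v-closure, commutes with localization
    ([v_closure_localized]).

    Statement (1) follows at once: I D_M is divisorial when I is, and if it
    were equal to M D_M then M D_M would be divisorial, hence M as well.

    For (2), call N bad when I D_N is not divisorial.  If N is bad, then N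
    contains I and N is nondivisorial ([nondivisorial_maximal_of_local]); finite
    character makes the bad ideals finite in number.  The equality
    I = I^v M_1 ... M_n, over the bad M_i, is checked at each maximal ideal N:
    where N is not bad, I D_N = I^v D_N and the product of the M_i is not inside
    N; where N is bad, only the factor N survives and I D_N = I^v N D_N.

    Uniqueness is a computation with inverses.  A nondivisorial maximal M has
    M^v = D, that is (D : M) = D, so (D : B M_1 ... M_n) = (D : B) and
    I^v = B^v = B.  A bad N missing from the M_i would give
    I D_N = B D_N = I^v D_N, against the choice of N. *)

(** * Subrings of a field and localization at a maximal ideal *)

Section Subrings.
Variable K : fieldType.
Implicit Types (D F I J M N : set K) (x y : K).

Definition quotient_subring D : Prop :=
  [/\ D 1, forall x y, D x -> D y -> D (x - y),
      forall x y, D x -> D y -> D (x * y)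
    & forall x, exists a b, [/\ D a, D b, b != 0 & x = a / b]].

(** F D_N as a set of single fractions: for a submodule F of D this agrees with
    the product of F and the localization, see [extensionE]. *)
Definition localized D F N : set K :=
  [set x | exists s, [/\ D s, ~ N s & F (s * x)]].

Variable D : set K.
Hypothesis Dsub : quotient_subring D.

Lemma subring1 : D 1. Proof. by case: Dsub. Qed.

Lemma subring0 : D 0.
Proof. by case: Dsub => D1 DB _ _; rewrite -(subrr 1); apply: DB. Qed.

Lemma subringM x y : D x -> D y -> D (x * y).
Proof. by case: Dsub => _ _ DM _; apply: DM. Qed.

Lemma subringD x y : D x -> D y -> D (x + y).
Proof.
case: Dsub => _ DB _ _ Dx Dy; rewrite -(opprK y) -(sub0r y).
by apply: (DB) => //; apply: (DB) => //; exact: subring0.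
Qed.

Lemma subringX x n : D x -> D (x ^+ n).
Proof.
move=> Dx; elim: n => [|n IHn]; first by rewrite expr0; exact: subring1.
by rewrite exprS; exact: subringM.
Qed.

Lemma fractionP x : exists a b, [/\ D a, D b, b != 0 & x = a / b].
Proof. by case: Dsub => _ _ _; apply. Qed.

Lemma submodule_self : submodule D D.
Proof.
split; [exact: subring0 | exact: subringD | exact: subringM].
Qed.

Lemma ideal_proper I : ideal D I -> I <> D <-> ~ I 1.
Proof.
move=> [[_ _ IM] sID]; split=> [neqID I1|nI1 eqID].
  apply: neqID; apply/seteqP; split=> // x Dx.
  by rewrite -(mulr1 x); exact: IM.
by apply: nI1; rewrite eqID; exact: subring1.
Qed.

Section Maximal.
Variable M : set K.
Hypothesis Mmax : maximal_ideal D M.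

Lemma maximal_submodule : submodule D M. Proof. by case: Mmax => -[]. Qed.

Lemma maximal_sub x : M x -> D x. Proof. by case: Mmax => -[_ +] _ _; apply. Qed.

Lemma maximalM x y : D x -> M y -> M (x * y).
Proof. by case: maximal_submodule => _ _; apply. Qed.

Lemma maximal1 : ~ M 1.
Proof. by case: Mmax => idM neqMD _; apply/(ideal_proper idM). Qed.

(** The ideal M + xD is D as soon as x is outside M; multiply 1 = m + dx by y. *)
Lemma maximal_prime x y : D x -> D y -> M (x * y) -> M x \/ M y.
Proof.
move=> Dx Dy Mxy; have [Mx|nMx] := pselect (M x); [by left | right].
have [M0 MD MM] := maximal_submodule.
case: Mmax => idM neqMD maxM.
pose J := [set z | exists m d, [/\ M m, D d & z = m + d * x]].
have idJ : ideal D J.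
  split; first split.
  - by exists 0, 0; split=> //; [exact: subring0 | ring].
  - move=> _ _ [m [d [Mm Dd ->]]] [m' [d' [Mm' Dd' ->]]].
    exists (m + m'), (d + d'); split; [exact: MD | exact: subringD | ring].
  - move=> a _ Da [m [d [Mm Dd ->]]].
    exists (a * m), (a * d); split; [exact: MM | exact: subringM | ring].
  move=> _ [m [d [Mm Dd ->]]]; apply: subringD; first exact: maximal_sub.
  exact: subringM.
have [|eqJ|eqJ] := maxM J idJ.
- by move=> m Mm; exists m, 0; split=> //; [exact: subring0 | ring].
- by case: nMx; rewrite -eqJ; exists 0, 1; split=> //; [exact: subring1 | ring].
have [m [d [Mm Dd one]]] : J 1 by rewrite eqJ; exact: subring1.
have -> : y = y * m + d * (x * y) by rewrite -[LHS]mulr1 one; ring.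
by apply: MD; apply: MM.
Qed.

Lemma maximal_primeC x y : D x -> D y -> ~ M x -> ~ M y -> ~ M (x * y).
Proof. by move=> Dx Dy nMx nMy /(maximal_prime Dx Dy) []. Qed.

Lemma maximal_primeX x n : D x -> M (x ^+ n) -> M x.
Proof.
move=> Dx; elim: n => [|n IHn]; first by rewrite expr0 => /maximal1.
by rewrite exprS => /(maximal_prime Dx (subringX n Dx)) [].
Qed.

Lemma maximal_compl_neq0 x : ~ M x -> x != 0.
Proof.
move=> nMx; apply/eqP => x0; apply: nMx; rewrite x0.
by case: maximal_submodule.
Qed.

Lemma localized_sub F x : F x -> localized D F M x.
Proof.
by move=> Fx; exists 1; split; [exact: subring1|exact: maximal1|rewrite mul1r].
Qed.

Lemma localizedS F F' : F `<=` F' -> localized D F M `<=` localized D F' M.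
Proof. by move=> sFF' x [s [Ds nMs /sFF' ?]]; exists s. Qed.

Lemma localizedM F x y : submodule D F ->
  localized D D M x -> localized D F M y -> localized D F M (x * y).
Proof.
move=> [_ _ FM] [s [Ds nMs Dsx]] [t [Dt nMt Fty]]; exists (s * t); split.
- exact: subringM.
- exact: maximal_primeC.
have -> : s * t * (x * y) = s * x * (t * y) by ring.
exact: FM.
Qed.

Lemma localizedD F x y : submodule D F ->
  localized D F M x -> localized D F M y -> localized D F M (x + y).
Proof.
move=> [_ FD FM] [s [Ds nMs Fsx]] [t [Dt nMt Fty]]; exists (s * t); split.
- exact: subringM.
- exact: maximal_primeC.
have -> : s * t * (x + y) = t * (s * x) + s * (t * y) by ring.
by apply: FD; apply: FM.
Qed.

Lemma localized_scale F s x : submodule D F ->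
  D s -> ~ M s -> localized D F M (s * x) -> localized D F M x.
Proof.
move=> subF Ds nMs [t [Dt nMt Ftsx]]; exists (t * s); split.
- exact: subringM.
- exact: maximal_primeC.
by rewrite -mulrA.
Qed.

Lemma localized_inv s : D s -> ~ M s -> localized D D M s^-1.
Proof.
move=> Ds nMs; exists s; split=> //.
by rewrite divff ?maximal_compl_neq0 //; exact: subring1.
Qed.

Lemma localized_submodule F : submodule D F ->
  submodule (localized D D M) (localized D F M).
Proof.
move=> subF; split; last by move=> *; apply: localizedM.
- by apply: localized_sub; case: subF.
- by move=> *; apply: localizedD.
Qed.

Lemma localizationE : localization D M = localized D D M.
Proof.
apply/seteqP; split=> x.
  move=> [a [s [Da Ds nMs ->]]]; exists s; split=> //.
  by rewrite mulrC divfK ?maximal_compl_neq0.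
move=> [s [Ds nMs Dsx]]; exists (s * x), s; split=> //.
by rewrite mulrC mulKf ?maximal_compl_neq0.
Qed.

Lemma extensionE F : submodule D F ->
  ideal_mul F (localization D M) = localized D F M.
Proof.
move=> subF; rewrite localizationE; apply/seteqP; split=> x.
  move=> [n [a [b [Fa Db ->]]]].
  elim/big_ind: _ => [|y z|i _].
  - by apply: localized_sub; case: subF.
  - exact: localizedD.
  by rewrite mulrC; apply: localizedM => //; apply: localized_sub.
move=> [s [Ds nMs Fsx]].
exists 1%N, (fun=> s * x), (fun=> s^-1); split=> // [_|].
  exact: localized_inv.
by rewrite big_ord1 mulrC mulKf ?maximal_compl_neq0.
Qed.

Lemma localized_maximal x : D x -> localized D M M x -> M x.
Proof. by move=> Dx [s [Ds nMs]] /(maximal_prime Ds Dx) []. Qed.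

(** An ideal not contained in M becomes the unit ideal of D_M. *)
Lemma localized_full I : submodule D I -> ~ I `<=` M -> I `<=` D ->
  localized D D M `<=` localized D I M.
Proof.
move=> subI nsIM sID x Dx.
have [s [Is nMs]] : exists s, I s /\ ~ M s.
  apply: contrapT => H; apply: nsIM => s Is; apply: contrapT => nMs.
  by apply: H; exists s.
apply: (@localized_scale _ s) => //; first exact: sID.
by rewrite mulrC; apply: localizedM => //; exact: localized_sub.
Qed.

End Maximal.

(** * Maximal ideals and the passage from local to global *)

(** Zorn's lemma on the sets A for which I together with A forms a proper ideal;
    adjoining I keeps the union of the empty chain admissible. *)
Lemma exists_maximal I : ideal D I -> ~ I 1 ->
  exists M, maximal_ideal D M /\ I `<=` M.
Proof.
move=> idI nI1.
pose P := [set A : set K | ideal D (I `|` A) /\ ~ (I `|` A) 1].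
have [|A [[idA nA1] maxA]] := @Zorn_bigcup _ P.
  move=> C sCP totC; set U := \bigcup_(X in C) X.
  have IU X : C X -> I `|` X `<=` I `|` U.
    by move=> CX x [Ix|Xx]; [left | right; exists X].
  have [[I0 ID IM] sID] := idI.
  (* Two members of the union of the chain lie in a common I `|` X. *)
  have pair x y : (I `|` U) x -> (I `|` U) y -> (I x /\ I y) \/
      exists X, [/\ C X, (I `|` X) x & (I `|` X) y].
    move=> [Ix|[X CX Xx]] [Iy|[Y CY Yy]]; first by left.
    - by right; exists Y; split=> //; [left | right].
    - by right; exists X; split=> //; [right | left].
    right; have [sXY|sYX] := totC X Y CX CY.
      by exists Y; split=> //; right=> //; apply: sXY.
    by exists X; split=> //; right=> //; apply: sYX.
  split; last first.
    move=> U1; have [[]//|[X [CX X1 _]]] := pair _ _ U1 U1.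
    by have [_] := sCP X CX; apply.
  split; first split.
  - by left.
  - move=> x y Ux Uy; have [[Ix Iy]|[X [CX Xx Xy]]] := pair _ _ Ux Uy.
      by left; apply: ID.
    by apply: (IU X) => //; have [[[_ XD _] _] _] := sCP X CX; apply: XD.
  - move=> a x Da Ux; have [[Ix _]|[X [CX Xx _]]] := pair _ _ Ux Ux.
      by left; apply: IM.
    by apply: (IU X) => //; have [[[_ _ XM] _] _] := sCP X CX; apply: XM.
  move=> x Ux; have [[Ix _]|[X [CX Xx _]]] := pair _ _ Ux Ux; first exact: sID.
  by have [[_ XD] _] := sCP X CX; apply: XD.
exists (I `|` A); split; last by left.
split=> //; first by apply/ideal_proper.
move=> J idJ sAJ; have [J1|nJ1] := pselect (J 1).
  right; apply/seteqP; split; first by case: idJ.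
  by move=> x Dx; rewrite -(mulr1 x); case: idJ => -[_ _ JM] _; apply: JM.
left; apply/seteqP; split=> // x Jx; right; apply: contrapT => nAx.
have IJ : I `|` J = J.
  by apply/seteqP; split=> [y [Iy|//]|y Jy]; [apply: sAJ; left | right].
apply: (maxA J); last by split; rewrite IJ.
by split=> [y Ay|sJA]; [apply: sAJ; right | apply: nAx; apply: sJA].
Qed.

(** F is the intersection of its localizations: the conductor of x into F is an
    ideal that no maximal ideal contains, so it contains 1. *)
Lemma local_global F x : submodule D F ->
  (forall M, maximal_ideal D M -> localized D F M x) -> F x.
Proof.
move=> [F0 FD FM] locx.
pose J := [set d | D d /\ F (d * x)].
have idJ : ideal D J.
  split; last by move=> ? [].
  split; first by split; [exact: subring0 | rewrite mul0r].
    move=> a b [Da Fa] [Db Fb]; split; first exact: subringD.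
    by rewrite mulrDl; apply: FD.
  move=> a b Da [Db Fb]; split; first exact: subringM.
  by rewrite -mulrA; apply: FM.
apply: contrapT => nFx.
have [|M [Mmax sJM]] := exists_maximal idJ; first by case; rewrite mul1r.
have [s [Ds nMs Fsx]] := locx M Mmax.
by apply: nMs; apply: sJM.
Qed.

Lemma maximal_not_sub M N : maximal_ideal D M -> maximal_ideal D N -> M <> N ->
  exists p, M p /\ ~ N p.
Proof.
move=> Mmax Nmax neqMN; apply: contrapT => H; apply: neqMN.
have sMN : M `<=` N.
  by move=> p Mp; apply: contrapT => nNp; apply: H; exists p.
have [_ _ maxM] := Mmax; have [idN neqND _] := Nmax.
by have [->|/neqND] := maxM N idN sMN.
Qed.

(** * The divisorial closure *)

Lemma v_closure_sub I : I `<=` v_closure D I.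
Proof. by move=> x Ix y invy; rewrite mulrC; exact: invy. Qed.

Lemma v_closure_sub_domain I : I `<=` D -> v_closure D I `<=` D.
Proof.
by move=> sID x /(_ 1); rewrite mulr1; apply=> y /sID; rewrite mul1r.
Qed.

Lemma submodule_inv F : submodule D (ideal_inv D F).
Proof.
split.
- by move=> y _; rewrite mul0r; exact: subring0.
- by move=> x y Fx Fy z Fz; rewrite mulrDl; apply: subringD; [exact: Fx|exact: Fy].
- by move=> a x Da Fx z Fz; rewrite -mulrA; apply: subringM => //; exact: Fx.
Qed.

Lemma divisorial_v_closure I : nonzero_ideal D I -> divisorial D (v_closure D I).
Proof.
move=> [[subI sID] [i Ii i0]]; split.
  split; last by exists i => //; exact: v_closure_sub.
  by split; [exact: submodule_inv | exact: v_closure_sub_domain].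
apply/seteqP; split; first exact: v_closure_sub.
by move=> x vvx y invy; apply: vvx => z; rewrite mulrC; apply.
Qed.

(** Divisoriality of a maximal ideal can be tested at M itself, because M is
    the contraction of its extension to D_M. *)
Lemma divisorial_maximal_of_extension M : nonzero_ideal D M ->
  maximal_ideal D M -> localized D (v_closure D M) M = localized D M M ->
  divisorial D M.
Proof.
move=> nzM Mmax locE; split=> //; apply/seteqP; split; first exact: v_closure_sub.
move=> x vx; have Dx : D x.
  by apply: v_closure_sub_domain vx; exact: maximal_sub.
by apply: localized_maximal => //; rewrite -locE; exact: localized_sub.
Qed.

(** * Products of ideals *)

Lemma mem_ideal_mul I J x y : I x -> J y -> ideal_mul I J (x * y).
Proof.
by move=> Ix Jy; exists 1%N, (fun=> x), (fun=> y); split=> //; rewrite big_ord1.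
Qed.

Lemma ideal_mul_ind I J F : submodule D F ->
  (forall x y, I x -> J y -> F (x * y)) -> ideal_mul I J `<=` F.
Proof.
move=> [F0 FD _] IJF x [n [a [b [Ia Jb ->]]]].
by elim/big_ind: _ => // i _; exact: IJF.
Qed.

Lemma submodule_ideal_mul I J : submodule D I -> submodule D (ideal_mul I J).
Proof.
move=> [I0 ID IM]; split.
- by exists 0%N, (fun=> 0), (fun=> 0); split=> [[]|[]|] //; rewrite big_ord0.
- move=> _ _ [n [a [b [Ia Jb ->]]]] [m [a' [b' [Ia' Jb' ->]]]].
  pose h (u : 'I_n -> K) (v : 'I_m -> K) (k : 'I_(n + m)) :=
    match fintype.split k with inl i => u i | inr j => v j end.
  exists (n + m)%N, (h a a'), (h b b'); split.
  + by move=> k; rewrite /h; case: splitP.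
  + by move=> k; rewrite /h; case: splitP.
  rewrite big_split_ord; congr (_ + _); apply: eq_bigr => i _; rewrite /h.
    by rewrite (unsplitK (inl i)).
  by rewrite (unsplitK (inr i)).
- move=> a _ Da [n [u [v [Iu Jv ->]]]].
  exists n, (fun i => a * u i), v; split=> //; first by move=> i; exact: IM.
  by rewrite big_distrr; apply: eq_bigr => i _ /=; rewrite mulrA.
Qed.

Section Products.
Variables (T : eqType) (Ms : T -> set K).
Hypothesis Ms_max : forall i, maximal_ideal D (Ms i).

Lemma big_ideal_mul_sub (l : seq T) :
  \big[@ideal_mul K/D]_(i <- l) Ms i `<=` D.
Proof.
elim: l => [|i l IHl]; rewrite ?big_nil ?big_cons //.
apply: ideal_mul_ind; first exact: submodule_self.
by move=> x y /(maximal_sub (Ms_max i)) Dx /IHl; exact: subringM.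
Qed.

Lemma big_ideal_mul_sub_factor (l : seq T) i : i \in l ->
  \big[@ideal_mul K/D]_(j <- l) Ms j `<=` Ms i.
Proof.
elim: l => [//|j l IHl]; rewrite inE big_cons => il.
apply: ideal_mul_ind; first exact: maximal_submodule.
move=> x y Mx My; case/predU1P: il => [->|il].
  rewrite mulrC; apply: maximalM => //.
  exact: big_ideal_mul_sub My.
by apply: (maximalM (Ms_max i)); [exact: (maximal_sub (Ms_max j)) | exact: IHl].
Qed.

(** By primeness, a product of maximal ideals all different from N escapes N. *)
Lemma big_ideal_mul_avoid (l : seq T) N : maximal_ideal D N ->
  (forall i, i \in l -> Ms i <> N) ->
  exists p, (\big[@ideal_mul K/D]_(i <- l) Ms i) p /\ ~ N p.
Proof.
move=> Nmax; elim: l => [|i l IHl] neqN.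
  by exists 1; rewrite big_nil; split; [exact: subring1 | exact: maximal1].
have [j jl|p [Pp nNp]] := IHl; first by apply: neqN; rewrite inE jl orbT.
have [q [Mq nNq]] := maximal_not_sub (Ms_max i) Nmax (neqN i (mem_head _ _)).
exists (q * p); split; first by rewrite big_cons; exact: mem_ideal_mul.
apply: maximal_primeC => //; first exact: (maximal_sub (Ms_max i)).
exact: big_ideal_mul_sub Pp.
Qed.

(** At the prime Ms j the product of the distinct ideals Ms i reduces to the
    single factor Ms j: every m in Ms j gets into the product after
    multiplication by some p that is a unit at Ms j. *)
Lemma big_ideal_mul_avoid_but (l : seq T) j m : injective Ms -> uniq l ->
  j \in l -> Ms j m ->
  exists p, [/\ D p, ~ Ms j p & (\big[@ideal_mul K/D]_(i <- l) Ms i) (m * p)].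
Proof.
move=> Minj + + Mm; elim: l => [//|i l IHl] /= /andP[il ul].
rewrite inE big_cons => /predU1P[ji|jl].
  have [|p [Pp nMp]] := @big_ideal_mul_avoid l _ (Ms_max j).
    by move=> k kl /Minj kj; move: il; rewrite -ji -kj kl.
  exists p; split=> //; first exact: big_ideal_mul_sub Pp.
  by apply: mem_ideal_mul => //; rewrite -ji.
have [p [Dp nMp Pmp]] := IHl ul jl.
have [|q [Mq nMq]] := maximal_not_sub (Ms_max i) (Ms_max j).
  by move=> /Minj ij; move: il; rewrite ij jl.
have Dq : D q by exact: (maximal_sub (Ms_max i)).
exists (q * p); split; [exact: subringM | exact: maximal_primeC |].
by rewrite mulrCA; exact: mem_ideal_mul.
Qed.

(** A nondivisorial maximal ideal M has M^v = D, hence (D : M) = D, and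
    the factors of a product can be removed one after the other. *)
Lemma ideal_inv_big (l : seq T) :
  (forall i, nondivisorial D (Ms i)) ->
  ideal_inv D (\big[@ideal_mul K/D]_(i <- l) Ms i) `<=` D.
Proof.
move=> Mnd; elim: l => [|i l IHl] x invx.
  by rewrite -(mulr1 x); apply: invx; rewrite big_nil; exact: subring1.
have [nzM neqM] := Mnd i.
have vM1 : v_closure D (Ms i) 1.
  (* M is maximal and properly contained in the ideal M^v. *)
  have [[idv _] _] := divisorial_v_closure nzM.
  have [_ _ maxM] := Ms_max i.
  have [E|->] := maxM _ idv (@v_closure_sub _); first by case: neqM.
  exact: subring1.
rewrite -(mul1r x); apply: vM1 => m Mm; apply: IHl => p Pp.
by rewrite -mulrA; apply: invx; rewrite big_cons; exact: mem_ideal_mul.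
Qed.

End Products.

(** * Localizations of a Pruefer domain are valuation domains *)

Section Prufer.
Hypothesis Dprufer : prufer D.
Variable M : set K.
Hypothesis Mmax : maximal_ideal D M.

(** The ideal F = (a, b) is invertible, so 1 is a sum of products u_i v_i with
    u_i in F and v_i in (D : F).  One of these products is outside M; expanding
    u_i, either v_i a or v_i b is outside M, and can serve as a denominator. *)
Lemma localized_valuation_elem a b : D a -> D b -> b != 0 ->
  localized D D M (a / b) \/ localized D D M (b / a).
Proof.
move=> Da Db b0.
pose g (i : 'I_2) := if i == ord0 then a else b.
pose F := [set x | exists2 c : 'I_2 -> K,
           forall i, D (c i) & x = \sum_(i < 2) c i * g i].
have FP x : F x <-> exists r s, [/\ D r, D s & x = r * a + s * b].
  split=> [[c Dc ->]|[r [s [Dr Ds ->]]]].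
    by exists (c ord0), (c (lift ord0 ord0)); rewrite big_ord_recl big_ord1.
  exists (fun i => if i == ord0 then r else s); first by move=> i; case: ifP.
  by rewrite big_ord_recl big_ord1.
have idF : nonzero_ideal D F.
  split; last first.
    exists b => //; apply/FP; exists 0, 1.
    by split; [exact: subring0|exact: subring1|ring].
  split; first split.
  - by apply/FP; exists 0, 0; split; [exact: subring0|exact: subring0|ring].
  - move=> x y /FP[r [s [Dr Ds ->]]] /FP[r' [s' [Dr' Ds' ->]]]; apply/FP.
    by exists (r + r'), (s + s'); split; [exact: subringD|exact: subringD|ring].
  - move=> c x Dc /FP[r [s [Dr Ds ->]]]; apply/FP.
    by exists (c * r), (c * s); split; [exact: subringM|exact: subringM|ring].
  by move=> x /FP[r [s [Dr Ds ->]]]; apply: subringD; apply: subringM.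
have Finv : invertible D F by apply: Dprufer => //; exists 2, g.
have [n [u [v [Fu vF one]]]] : ideal_mul F (ideal_inv D F) 1.
  by rewrite Finv; exact: subring1.
have Fa : F a.
  by apply/FP; exists 1, 0; split; [exact: subring1|exact: subring0|ring].
have Fb : F b.
  by apply/FP; exists 0, 1; split; [exact: subring0|exact: subring1|ring].
have [M0 MD MM] := maximal_submodule Mmax.
have [i nMi] : exists i, ~ M (u i * v i).
  apply: contrapT => H; apply: (maximal1 Mmax); rewrite one.
  by elim/big_ind: _ => // i _; apply: contrapT => nMi; apply: H; exists i.
have Dva : D (v i * a) by apply: vF.
have Dvb : D (v i * b) by apply: vF.
have /FP[r [s [Dr Ds ui]]] := Fu i.
have [Ma|nMa] := pselect (M (v i * a)); last first.
  right; exists (v i * a); split=> //.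
  have va0 := maximal_compl_neq0 Mmax nMa.
  have a0 : a != 0 by apply: contra_neq va0 => ->; rewrite mulr0.
  by have -> : v i * a * (b / a) = v i * b by field.
have [Mb|nMb] := pselect (M (v i * b)).
  case: nMi; rewrite ui.
  have -> : (r * a + s * b) * v i = r * (v i * a) + s * (v i * b) by ring.
  by apply: MD; apply: MM.
left; exists (v i * b); split=> //.
by have -> : v i * b * (a / b) = v i * a by field.
Qed.

Lemma localized_valuation x : localized D D M x \/ localized D D M x^-1.
Proof.
have [a [b [Da Db b0 ->]]] := fractionP x.
by rewrite invf_div; exact: localized_valuation_elem.
Qed.

(** Submodules of a valuation domain are comparable with principal ones, and an
    element x outside F D_M divides each element of F D_M by a nonunit. *)
Lemma localized_total F x y : submodule D F ->
  localized D F M y -> ~ localized D F M x -> localized D M M (y / x).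
Proof.
move=> subF Fy nFx.
have subF' := localized_submodule Mmax subF.
have x0 : x != 0.
  by apply: contra_not_neq nFx => ->; case: subF'.
have noloc u : localized D D M u -> x != u * y.
  by move=> Du; apply: contra_not_neq nFx => ->; exact: localizedM.
have [y0|y0] := eqVneq y 0.
  rewrite y0 mul0r; apply: localized_sub => //.
  by case: (maximal_submodule Mmax).
have [[s [Ds nMs Dsx]]|] := localized_valuation (y / x).
  have [//|nM] := pselect (M (s * (y / x))); first by exists s.
  have : x != s / (s * (y / x)) * y.
    apply: noloc; apply: localizedM => //; first exact: submodule_self.
      exact: localized_sub.
    exact: localized_inv.
  have s0 := maximal_compl_neq0 Mmax nMs.
  have -> : s / (s * (y / x)) * y = x by field; apply/and3P.
  by rewrite eqxx.
rewrite invf_div => /noloc; rewrite divfK ?eqxx //.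
Qed.

(** The product of J^v with the maximal ideal lies in J, for every submodule J of
    a valuation domain.  Otherwise some bp bounds J, so 1 / (bp) is in the
    inverse of J, and b / (bp) = 1 / p would be in D_M. *)
Lemma localized_v_mul F b p : submodule D F ->
  v_closure (localized D D M) (localized D F M) b -> localized D M M p ->
  localized D F M (b * p).
Proof.
move=> subF vb Mp; apply: contrapT => nF.
have subF' := localized_submodule Mmax subF.
have bp0 : b * p != 0.
  by apply: contra_not_neq nF => ->; case: subF'.
have [b0 p0] : b != 0 /\ p != 0 by apply/andP; rewrite -negb_or -mulf_eq0.
have Dp : localized D D M p^-1.
  have -> : p^-1 = b * (b * p)^-1 by field; apply/andP.
  apply: vb => y Fy; rewrite mulrC.
  (* y / (bp) is even in the maximal ideal of D_M, since bp is not in F D_M *)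
  have := localized_total subF Fy nF.
  by apply: localizedS; exact: maximal_sub.
have := localizedM Mmax (maximal_submodule Mmax) Dp Mp.
rewrite mulVf // => /(localized_maximal Mmax (subring1)).
exact: maximal1.
Qed.

End Prufer.

(** * Independence of localizations in an h-local domain *)

Section HLocal.
Hypothesis Dprufer : prufer D.
Hypothesis Dhlocal : h_local D.

(** Let P be the radical of the contraction to D of the ideal b D_M.  Since D_M is a
    valuation domain, P is prime; it is nonzero and contained in M, so h-locality
    provides y in P outside N.  Some power of y is b a / s with s outside
    M, and then s is a multiple of b in D_N. *)
Lemma separate_pair M N b : maximal_ideal D M -> maximal_ideal D N -> M <> N ->
  D b -> b != 0 -> exists t, [/\ D t, ~ M t & localized D D N (t / b)].
Proof.
move=> Mmax Nmax neqMN Db b0.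
have [Mb|nMb] := pselect (M b); last first.
  exists b; split=> //; rewrite divff //; apply: localized_sub => //.
  exact: subring1.
pose bM := [set x | localized D D M (x / b)].
pose P := [set y | D y /\ exists n, bM (y ^+ n)].
have bMM c x : localized D D M c -> bM x -> bM (c * x).
  rewrite /bM /= -mulrA; apply: localizedM => //; exact: submodule_self.
have locX c n : localized D D M c -> localized D D M (c ^+ n).
  move=> Dc; elim: n => [|n IHn].
    by rewrite expr0; apply: localized_sub => //; exact: subring1.
  by rewrite exprS; apply: localizedM => //; exact: submodule_self.
have PM y : P y -> M y.
  move=> [Dy [n [s [Ds nMs Dsy]]]]; apply: (maximal_primeX Mmax (n := n)) => //.
  have : M (s * y ^+ n).
    have -> : s * y ^+ n = s * (y ^+ n / b) * b by field.
    exact: maximalM.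
  by move=> /(maximal_prime Mmax Ds (subringX n Dy)) [].
have Pmul c y : localized D D M c -> D (c * y) -> P y -> P (c * y).
  move=> Dc Dcy [Dy [n bMy]]; split=> //; exists n.
  by rewrite exprMn; apply: bMM => //; exact: locX.
have loc1 : localized D D M 1 by apply: localized_sub => //; exact: subring1.
have quotD x y : localized D D M (x / y) \/ localized D D M (y / x).
  by rewrite -(invf_div x y); exact: localized_valuation.
have subP : submodule D P.
  have P0 : P 0.
    split; first exact: subring0.
    exists 1%N; rewrite /bM /= expr1 mul0r; apply: localized_sub => //.
    exact: subring0.
  split=> //; last first.
    move=> a x Da Px; apply: Pmul => //; first exact: localized_sub.
    by apply: subringM => //; case: Px.
  move=> x y Px Py; have [Dx Dy] : D x /\ D y by case: Px; case: Py.
  have [->|x0] := eqVneq x 0; first by rewrite add0r.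
  have [->|y0] := eqVneq y 0; first by rewrite addr0.
  have Dxy : D (x + y) by exact: subringD.
  have [Dq|Dq] := quotD x y.
    have e : x + y = (x / y + 1) * y by field.
    rewrite e; apply: Pmul => //; last by rewrite -e.
    by apply: localizedD => //; exact: submodule_self.
  have e : x + y = (y / x + 1) * x by field.
  rewrite e; apply: Pmul => //; last by rewrite -e.
  by apply: localizedD => //; exact: submodule_self.
have idP : ideal D P by split=> // y [].
have Pb : P b.
  by split=> //; exists 1%N; rewrite /bM /= expr1 divff.
(* when v divides u in D_M, u^2 is a multiple of uv *)
have half u v n : D u -> D v -> v != 0 -> localized D D M (u / v) ->
    bM ((u * v) ^+ n) -> P u.
  move=> Du Dv v0 Dq bMuv; split=> //; exists (n + n)%N.
  have -> : u ^+ (n + n) = (u / v) ^+ n * (u * v) ^+ n.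
    rewrite -exprMn exprD -exprMn; congr (_ ^+ _); by field.
  by apply: bMM => //; exact: locX.
have primeP : prime_ideal D P.
  split=> //.
    by apply/(ideal_proper idP) => /PM; exact: maximal1.
  move=> x y Dx Dy [_ [n bMxy]].
  have [P0 _ _] := subP.
  have [->|x0] := eqVneq x 0; first by left.
  have [->|y0] := eqVneq y 0; first by right.
  have [Dq|Dq] := quotD x y.
    by left; apply: (half x y n).
  by right; apply: (half y x n) => //; rewrite mulrC.
have [Q [_ uniqQ]] := Dhlocal.2 P primeP (conj idP (ex_intro2 _ _ b Pb b0)).
have [y [Py nNy]] : exists y, P y /\ ~ N y.
  apply: contrapT => H; apply: neqMN.
  rewrite -(uniqQ M) ?(uniqQ N) //; split=> // y Py.
  by apply: contrapT => nNy; apply: H; exists y.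
have [Dy [n [s [Ds nMs Dsy]]]] := Py.
exists s; split=> //; exists (y ^+ n); split; first exact: subringX.
  by move/(maximal_primeX Nmax Dy).
by have -> : y ^+ n * (s / b) = s * (y ^+ n / b) by field.
Qed.

(** Only finitely many N contain b; b is a unit at the others, so a product
    of the elements given by [separate_pair] is enough. *)
Lemma separate M b : maximal_ideal D M -> D b -> b != 0 ->
  exists t, [/\ D t, ~ M t & forall N, maximal_ideal D N -> N <> M ->
                                       localized D D N (t / b)].
Proof.
move=> Mmax Db b0.
have /finite_seqP[l lE] := Dhlocal.1 b Db b0.
have [t [Dt nMt tl]] : exists t, [/\ D t, ~ M t &
    forall N, maximal_ideal D N -> N <> M -> N \in l -> localized D D N (t / b)].
  elim: l {lE} => [|N l [t [Dt nMt tl]]].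
    by exists 1; split=> //; [exact: subring1 | exact: maximal1].
  have [[Nmax neqNM]|nN] := pselect (maximal_ideal D N /\ N <> M); last first.
    exists t; split=> // N' N'max neqN'; rewrite inE.
    by move=> /predU1P[N'E|]; [case: nN; rewrite -N'E | exact: tl].
  have [u [Du nMu uN]] := separate_pair Mmax Nmax (nesym neqNM) Db b0.
  exists (u * t); split; [exact: subringM | exact: maximal_primeC |].
  move=> N' N'max neqN'; rewrite inE => /predU1P[->|N'l].
    rewrite mulrAC mulrC; apply: localizedM => //; first exact: submodule_self.
    exact: localized_sub.
  rewrite -mulrA; apply: localizedM => //; first exact: submodule_self.
    exact: localized_sub.
  exact: tl.
exists t; split=> // N Nmax neqNM.
have [Nb|nNb] := pselect (N b).
  by apply: tl => //; have : [set` l] N by rewrite -lE.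
by exists b; split=> //; rewrite mulrC divfK.
Qed.

(** If xF has the common denominator b and lies in D_M, then it has a common
    denominator outside M. *)
Lemma localized_bounded F M b x : maximal_ideal D M -> D b -> b != 0 ->
  (forall y, F y -> D (b * (x * y))) ->
  (forall y, F y -> localized D D M (x * y)) ->
  exists t, [/\ D t, ~ M t & forall y, F y -> D (t * x * y)].
Proof.
move=> Mmax Db b0 Fb Floc.
have [t [Dt nMt tN]] := separate Mmax Db b0.
exists t; split=> // y Fy; apply: local_global => [|N Nmax].
  exact: submodule_self.
have [->|neqNM] := pselect (N = M).
  rewrite -mulrA; apply: localizedM => //; first exact: submodule_self.
    exact: localized_sub.
  exact: Floc.
have -> : t * x * y = t / b * (b * (x * y)) by field.
apply: localizedM => //; first exact: submodule_self.
  exact: tN.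
by apply: localized_sub => //; exact: Fb.
Qed.

(** * Divisorial closure and localization *)

(** Localization commutes with the v-closure because it commutes with
    F |-> (D : F) twice: elements of the double inverse and of the inverse are
    fractions, so the families involved are bounded and [localized_bounded]
    applies to each of them. *)
Lemma v_closure_localized I M : nonzero_ideal D I -> maximal_ideal D M ->
  v_closure (localized D D M) (localized D I M) = localized D (v_closure D I) M.
Proof.
move=> [[subI sID] [i Ii i0]] Mmax; apply/seteqP; split=> x.
  move=> vx; have [a [c [Da Dc c0 xE]]] := fractionP x.
  have [||y invy|y invy|t [Dt nMt tx]] :=
      @localized_bounded (ideal_inv D I) M (c * i) x Mmax.
  - by apply: subringM => //; exact: sID.
  - by rewrite mulf_neq0.
  - have -> : c * i * (x * y) = a * (y * i) by rewrite xE; field.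
    by apply: subringM => //; exact: invy.
  - apply: vx => z [s [Ds nMs Isz]]; exists s; split=> //.
    by rewrite mulrCA; apply: invy.
  by exists t.
move=> [s [Ds nMs vsx]] y invy.
have [a [c [Da Dc c0 yE]]] := fractionP y.
have [z Iz|z Iz|t [Dt nMt ty]] := @localized_bounded I M c y Mmax Dc c0.
- have -> : c * (y * z) = a * z by rewrite yE; field.
  by apply: subringM => //; exact: sID.
- by apply: invy; apply: localized_sub.
exists (s * t); split; [exact: subringM | exact: maximal_primeC |].
have -> : s * t * (x * y) = s * x * (t * y) by ring.
by apply: vsx => z Iz; apply: ty.
Qed.

Lemma nonzero_ideal_extension I M : nonzero_ideal D I -> maximal_ideal D M ->
  nonzero_ideal (localization D M) (ideal_mul I (localization D M)).
Proof.
move=> [[subI sID] [i Ii i0]] Mmax; rewrite extensionE // localizationE //.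
split; first split; first exact: localized_submodule.
  exact: localizedS.
by exists i => //; exact: localized_sub.
Qed.

Lemma v_closure_extension I M : nonzero_ideal D I -> maximal_ideal D M ->
  v_closure (localization D M) (ideal_mul I (localization D M)) =
  localized D (v_closure D I) M.
Proof.
move=> nzI Mmax; have [[subI _] _] := nzI.
by rewrite extensionE // localizationE // v_closure_localized.
Qed.

Lemma divisorial_extension I M : divisorial D I -> maximal_ideal D M ->
  divisorial (localization D M) (ideal_mul I (localization D M)).
Proof.
move=> [nzI IE] Mmax; split; first exact: nonzero_ideal_extension.
by have [[subI _] _] := nzI; rewrite v_closure_extension // extensionE // -IE.
Qed.

(** If I D_M = M D_M with I divisorial, then M D_M is divisorial, and so is M. *)
Lemma nondivisorial_extension_proper I M : divisorial D I ->
  maximal_ideal D M -> nondivisorial D M -> I `<=` M ->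
  ideal_mul I (localization D M) `<` ideal_mul M (localization D M).
Proof.
move=> [nzI IE] Mmax [nzM ndM] sIM.
have [[subI _] _] := nzI.
have subM := maximal_submodule Mmax.
rewrite !extensionE //; split; first exact: localizedS.
move=> sMI; apply: ndM.
have locE : localized D I M = localized D M M.
  by apply/seteqP; split=> //; exact: localizedS.
suff [] : divisorial D M by [].
apply: divisorial_maximal_of_extension => //.
by rewrite -v_closure_localized // -locE v_closure_localized // -IE.
Qed.

(** A failure of I^v D_N <= I D_N at N forces N to contain I and to be
    nondivisorial.  For the latter, I D_N lies in b N D_N, so each x in (D : N)
    has x / b in the inverse of I D_N; as b is in the v-closure, x is
    in D_N.  At every other maximal ideal N extends to the unit ideal, so x is
    in D and (D : N) = D. *)
Lemma nondivisorial_maximal_of_local I N b : nonzero_ideal D I ->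
  maximal_ideal D N -> v_closure D I b -> ~ localized D I N b ->
  nondivisorial_maximal_at D I N.
Proof.
move=> nzI Nmax vb nIb.
have [[subI sID] [i Ii i0]] := nzI.
have Db : D b by apply: v_closure_sub_domain vb.
have sIN : I `<=` N.
  apply: contrapT => nsIN; apply: nIb; apply: (localized_full Nmax) => //.
  exact: localized_sub.
have vNb : v_closure (localized D D N) (localized D I N) b.
  by rewrite v_closure_localized //; exact: localized_sub.
split=> //; last first.
  split; first exact: nonzero_ideal_extension.
  move=> E; apply: nIb; rewrite -extensionE // E v_closure_extension //.
  exact: localized_sub.
have nzN : nonzero_ideal D N.
  by split; [case: Nmax | exists i => //; exact: sIN].
split=> // NE; apply: (maximal1 Nmax); rewrite NE => x invx; rewrite mul1r.
have b0 : b != 0.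
  by apply: contra_not_neq nIb => ->; apply: localized_sub => //; case: subI.
apply: local_global => [|N' N'max]; first exact: submodule_self.
have [->|neqN] := pselect (N' = N); last first.
  have [p [Np nN'p]] := maximal_not_sub Nmax N'max (nesym neqN).
  exists p; split=> //; first exact: (maximal_sub Nmax).
  by rewrite mulrC; exact: invx.
have -> : x = b * (x / b) by field.
apply: vNb => y Iy.
have [s [Ds nNs Nsy]] := localized_total Dprufer Nmax subI Iy nIb.
exists s; split=> //.
have -> : s * (x / b * y) = x * (s * (y / b)) by field.
exact: invx.
Qed.

(** * Existence and uniqueness of the factorization *)

(** The factors are all the maximal ideals at which I is not locally
    divisorial.  Their number is positive since an empty product would make I
    equal to its v-closure. *)
Lemma factorization_exists I : nondivisorial D I ->
  exists n B (Ms : 'I_n -> set K), (0 < n)%N /\ factorization D I B Ms.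
Proof.
move=> [nzI neqI]; have [[subI sID] [i0 Ii0 i0_neq0]] := nzI.
pose bad := [set N | nondivisorial_maximal_at D I N].
have /finite_seqP[l0 l0E] : finite_set bad.
  apply: sub_finite_set (Dhlocal.1 i0 (sID _ Ii0) i0_neq0) => N [Nmax _ sIN _].
  by split=> //; exact: sIN.
pose l := undup l0.
have lE N : N \in l <-> bad N by rewrite mem_undup l0E.
pose Ms (i : 'I_(size l)) := tnth (in_tuple l) i.
have badM i : bad (Ms i) by apply/lE; exact: mem_tnth.
have Mmax i : maximal_ideal D (Ms i) by case: (badM i).
have Minj : injective Ms by apply/tuple_uniqP; exact: undup_uniq.
pose B := v_closure D I.
have divB : divisorial D B by exact: divisorial_v_closure.
pose P := \big[@ideal_mul K/D]_(i < size l) Ms i.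
have PD x : P x -> D x by exact: big_ideal_mul_sub.
have subBP : submodule D (ideal_mul B P).
  by apply: submodule_ideal_mul; case: divB => -[[]].
have IE : I = ideal_mul B P.
  apply/seteqP; split=> [y Iy|].
    apply: local_global => // N Nmax.
    have [[j MjN]|nN] := pselect (exists j, Ms j = N); last first.
      have [|p [Pp nNp]] := big_ideal_mul_avoid Mmax (l := index_enum _) Nmax.
        by move=> i _ MiN; apply: nN; exists i.
      exists p; split=> //; first exact: PD.
      by rewrite mulrC; apply: mem_ideal_mul => //; exact: v_closure_sub.
    (* at N = Ms j one has I D_N = x N D_N for any x of I^v outside I D_N,
       so y is x times an element of N, up to a denominator *)
    have [x [Bx nIx]] : exists x, B x /\ ~ localized D I N x.
      apply: contrapT => H.
      have [_ _ _ [_ ndI]] := badM j; apply: ndI.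
      rewrite v_closure_extension // extensionE // MjN.
      apply/seteqP; split; first by apply: localizedS; exact: v_closure_sub.
      move=> x [s [Ds nNs Bsx]]; apply: (localized_scale Nmax subI Ds nNs).
      by apply: contrapT => nIsx; apply: H; exists (s * x).
    have x0 : x != 0.
      by apply: contra_not_neq nIx => ->; apply: localized_sub => //; case: subI.
    have [s [Ds nNs Nsyx]] :=
      localized_total Dprufer Nmax subI (localized_sub Nmax Iy) nIx.
    rewrite -MjN in Nsyx nNs *.
    have [p [Dp nNp Pp]] := big_ideal_mul_avoid_but Mmax Minj
      (index_enum_uniq _) (mem_index_enum j) Nsyx.
    exists (s * p); split; [exact: subringM | exact: maximal_primeC |].
    have -> : s * p * y = x * (s * (y / x) * p) by field.
    exact: mem_ideal_mul.
  apply: (ideal_mul_ind subI) => b p vb Pp; apply: local_global => // N Nmax.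
  have [[i <-]|nN] := pselect (exists i, Ms i = N).
    apply: localized_v_mul => //.
      by rewrite v_closure_localized //; exact: localized_sub.
    apply: localized_sub => //.
    by apply: big_ideal_mul_sub_factor Pp => //; rewrite mem_index_enum.
  rewrite mulrC; apply: localizedM => //.
    by apply: localized_sub => //; exact: PD.
  apply: contrapT => nIb; apply: nN.
  have /lE Nl := nondivisorial_maximal_of_local nzI Nmax vb nIb.
  have /tnthP[i ->] : N \in in_tuple l by [].
  by exists i.
exists (size l), B, Ms; split; last by split.
rewrite lt0n; apply/eqP => size0; apply: neqI; apply/seteqP; split.
  exact: v_closure_sub.
move=> b Bb; rewrite IE -(mulr1 b); apply: mem_ideal_mul => //.
rewrite /P; case: (index_enum _) => [|i s].
  by rewrite big_nil; exact: subring1.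
by have := ltn_ord i; rewrite {2}size0.
Qed.

(** B and I have the same inverse, because the factors M_i do not change
    inverses.  At an N different from all M_i, the ideals I and B = I^v agree
    locally, so I D_N is divisorial. *)
Lemma factorization_unique I n B (Ms : 'I_n -> set K) :
  nonzero_ideal D I -> factorization D I B Ms ->
  B = v_closure D I /\
  forall N, nondivisorial_maximal_at D I N -> exists i, Ms i = N.
Proof.
move=> nzI [divB _ badM IE].
set P := \big[_/_]_(i < n) Ms i in IE.
have Mmax i : maximal_ideal D (Ms i) by case: (badM i).
have Mnd i : nondivisorial D (Ms i) by case: (badM i).
have [[[subB sBD] _] BE] := divB.
have sIB : I `<=` B.
  rewrite IE; apply: ideal_mul_ind => // b p Bb Pp; rewrite mulrC.
  case: subB => _ _; apply=> //; exact: big_ideal_mul_sub Pp.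
have invE : ideal_inv D I = ideal_inv D B.
  apply/seteqP; split=> x invx y; last by move/sIB; exact: invx.
  move=> By; apply: (ideal_inv_big Mmax (l := index_enum _)) => // p Pp.
  by rewrite -mulrA; apply: invx; rewrite IE; exact: mem_ideal_mul.
split; first by rewrite /v_closure invE.
move=> N [Nmax _ _ [_ ndN]]; apply: contrapT => nN; apply: ndN.
have [[subI _] _] := nzI; rewrite v_closure_extension // extensionE //.
rewrite /v_closure invE -/(v_closure D B) -BE.
apply/seteqP; split; first exact: localizedS.
have [|p [Pp nNp]] := big_ideal_mul_avoid Mmax (l := index_enum _) Nmax.
  by move=> i _ MiN; apply: nN; exists i.
have Dp := big_ideal_mul_sub Mmax Pp.
move=> x [s [Ds nNs Bsx]].
exists (s * p); split; [exact: subringM | exact: maximal_primeC |].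
by rewrite IE mulrAC; exact: mem_ideal_mul.
Qed.

End HLocal.
End Subrings.

(** * The copy of a domain inside its field of fractions *)

Lemma domain_image_quotient_subring (R : idomainType) :
  quotient_subring (domain_image R).
Proof.
split.
- by exists 1 => //; rewrite rmorph1.
- by move=> _ _ [x _ <-] [y _ <-]; exists (x - y) => //; rewrite rmorphB.
- by move=> _ _ [x _ <-] [y _ <-]; exists (x * y) => //; rewrite rmorphM.
move=> x; rewrite -[x]reprK; case: (repr x) => -[n d] /= d0.
exists (tofrac n), (tofrac d).
rewrite tofrac_eq0; split=> //; [by exists n | by exists d |].
have d0' : tofrac d != 0 :> {fraction R} by rewrite tofrac_eq0.
apply: (mulIf d0'); rewrite divfK //.
unlock FracField.tofrac; rewrite -[LHS]FracField.pi_mul.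
apply/eqmodP; rewrite /= FracField.equivfE /FracField.mulf /=.
by rewrite !numden_Ratio ?mulf_neq0 ?oner_neq0 // !mulr1 mulrC.
Qed.

Theorem theorem1p1 (R : idomainType)
    (Rprufer : prufer (domain_image R)) (Rhlocal : h_local (domain_image R)) :
  (forall I M : set {fraction R},
     divisorial (domain_image R) I ->
     maximal_ideal (domain_image R) M ->
     nondivisorial (domain_image R) M ->
     I `<=` M ->
     divisorial (localization (domain_image R) M)
       (ideal_mul I (localization (domain_image R) M)) /\
     ideal_mul I (localization (domain_image R) M) `<`
       ideal_mul M (localization (domain_image R) M)) /\
  (forall I : set {fraction R},
     nondivisorial (domain_image R) I ->
     (exists n (B : set {fraction R}) (M : 'I_n -> set {fraction R}),
        (0 < n)%N /\ factorization (domain_image R) I B M) /\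
     (forall n (B : set {fraction R}) (M : 'I_n -> set {fraction R}),
        factorization (domain_image R) I B M ->
        B = v_closure (domain_image R) I /\
        forall N : set {fraction R},
          nondivisorial_maximal_at (domain_image R) I N ->
          exists i, M i = N)).
Proof.
have Rsub := domain_image_quotient_subring R.
split=> [I M divI Mmax ndM sIM|I ndI].
  split; first exact: divisorial_extension.
  exact: nondivisorial_extension_proper.
split=> [|n B M factI]; first exact: factorization_exists.
by apply: factorization_unique factI => //; case: ndI.
Qed.
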